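(* Let $\tau>0$, $t_n=n\tau$, $f^n=f(t_n)$, and let $u_{ms}^n\in V_{ms}$ be the solution of $$\left(C\frac{u_{ms}^n-u_{ms}^{n-1}}{\tau},v_{ms}\right)+(Lu_{ms}^n,v_{ms})=(f^n,v_{ms})\quad\forall v_{ms}\in V_{ms},\ n=1,2,\dots,$$ with initial value $u_{ms}^0\in V_{ms}$. Then $u_{ms}^n$ is unconditionally stable (no restriction on $\tau>0$) and satisfies, for every $n\ge1$, $$\|u_{ms}^n\|_L^2\ \preceq\ \|u_{ms}^0\|_L^2+\tau\sum_{k=1}^n\|f^k\|^2_{\left(C+\frac{\tau}{2}L\right)^{-1}} .$$
   Context: **Network.** $G$ is a finite connected undirected weighted graph with nodes $x_1,\dots,x_{N_v}$ embedded in $\Omega=[0,L_1]\times\dots\times[0,L_d]$, $d\in\{2,3\}$, and symmetric weights $w_{ij}$, where $w_{ii}=0$, $w_{ij}=0$ if $x_i,x_j$ are not connected, and $0<\underline w\le w_{ij}\le\overline w<\infty$ if they are connected. Node coefficients satisfy $0<\underline c\le c_i\le\overline c<\infty$. With $d_i=\sum_{j=1}^{N_v}w_{ij}$, the graph Laplacian is $\operatorname{diag}(d_i)-(w_{ij})$. Dirichlet data may be prescribed on a set of boundary nodes. These nodes are eliminated: $L$ and $C$ denote the restrictions of the graph Laplacian and of $\operatorname{diag}(c_i)$ to the remaining nodes, and the Dirichlet data are absorbed into the right-hand side $f$. Thus $L$ is symmetric positive semidefinite, $C$ is diagonal with positive entries, and $V$ is the linear space of real functions (vectors) on the remaining nodes.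 The function $f$ takes values in $V$. Notation: $(u,v)=u^Tv$, $\|u\|_B^2=u^TBu$ for symmetric positive semidefinite $B$. **Multiscale space.** $\mathcal T_H$ is a uniform mesh of $\Omega$ into square/cubic cells of side $H$ with coarse nodes $y_1,\dots,y_N$. The set $\omega_i$ is the union of the cells having $y_i$ as a vertex, and $\chi_i$ is the (multi)linear hat function of $y_i$ (these form a partition of unity), evaluated at network nodes. $G^{\omega_i}$ is the main (largest) connected cluster of the sub-network of $G$ lying in $\omega_i$, and $\eta_i$ is the function on the nodes in $\omega_i$ equal to $0$ on $G^{\omega_i}$ and $1$ otherwise. $L^{\omega_i}=D^{\omega_i}-W^{\omega_i}$ is the graph Laplacian of $G^{\omega_i}$ with local degree matrix $D^{\omega_i}$ (invertible) and local weight matrix $W^{\omega_i}$. $\phi_r^{\omega_i}$ are the eigenvectors of $L^{\omega_i}\phi_r^{\omega_i}=\lambda_r^{\omega_i}D^{\omega_i}\phi_r^{\omega_i}$ ordered by increasing eigenvalue. With nodewise products and extension by zero, $\psi_1^{\omega_i}=\chi_i\eta_i$, $\psi_{r+1}^{\omega_i}=\chi_i\phi_r^{\omega_i}$, and $V_{ms}=\operatorname{span}\{\psi_r^{\omega_i}:1\le i\le N,\ 1\le r\le M_i\}\subset V$, where $M_i$ is the chosen number of local basis functions. **Notation $\preceq$.** $a\preceq b$ means $a\le c_0\,b$ with a constant $c_0>0$ independent of $\tau$, $n$, $f$, the initial value and the solution. *)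

(* Defs.v *)
From HB Require Import structures.
From mathcomp Require Import all_boot all_order all_algebra.
From mathcomp Require Import reals.

Set Implicit Arguments.
Unset Strict Implicit.
Unset Printing Implicit Defensive.

Import Order.TTheory GRing.Theory Num.Theory.
Local Open Scope ring_scope.

Definition dotv (R : realType) (n : nat) (u v : 'cV[R]_n) : R :=
  (u^T *m v) 0 0.

(* The squared (semi)norm u^T B u. *)
Definition normsq (R : realType) (n : nat) (B : 'M[R]_n) (u : 'cV[R]_n) : R :=
  (u^T *m B *m u) 0 0.

Definition degree_mx (R : realType) (n : nat) (W : 'M[R]_n) : 'M[R]_n :=
  diag_mx (\row_i \sum_j W i j).

Definition graph_laplacian (R : realType) (n : nat) (W : 'M[R]_n) : 'M[R]_n :=
  degree_mx W - W.

(* Connected weighted graphs with nodes in [0, ell 0] x ... x [0, ell (d-1)]. *)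
Record network (R : realType) (d : nat) (ell : 'I_d -> R) := Network {
  nv : nat;
  pos : 'I_nv -> 'rV[R]_d;
  pos_inj : injective pos;
  pos_in_domain : forall v k, 0 <= pos v 0 k <= ell k;
  edge : rel 'I_nv;
  edge_sym : symmetric edge;
  edge_irr : irreflexive edge;
  edge_connected : forall v v', connect edge v v';
  weight : 'M[R]_nv;
  weight_sym : weight^T = weight;
  weight_lo : R;
  weight_hi : R;
  weight_lo_gt0 : 0 < weight_lo;
  weight_nonedge : forall v v', ~~ edge v v' -> weight v v' = 0;
  weight_edge : forall v v', edge v v' -> weight_lo <= weight v v' <= weight_hi;
  coef : 'rV[R]_nv;
  coef_lo : R;
  coef_hi : R;
  coef_lo_gt0 : 0 < coef_lo;
  coef_bounds : forall v, coef_lo <= coef 0 v <= coef_hi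
}.

Section DirichletElimination.
Variables (R : realType) (d : nat) (ell : 'I_d -> R) (G : network ell).
(* Dir is the (possibly empty) set of nodes carrying Dirichlet data. *)
Variable Dir : {set 'I_(nv G)}.

Definition ndof : nat := #|~: Dir|.

Definition dof (a : 'I_ndof) : 'I_(nv G) := enum_val a.

Definition L_mx : 'M[R]_ndof := mxsub dof dof (graph_laplacian (weight G)).

Definition C_mx : 'M[R]_ndof := mxsub dof dof (diag_mx (coef G)).

End DirichletElimination.

(* The uniform mesh with m k cells of side H in direction k; coarse nodes and
   cells are given by their integer coordinates. *)
Definition coarse_node (d : nat) (m : 'I_d -> nat) : finType :=
  {dffun forall k : 'I_d, 'I_(m k).+1}.

Definition cell (d : nat) (m : 'I_d -> nat) : finType :=
  {dffun forall k : 'I_d, 'I_(m k)}.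

Section CoarseMesh.
Variables (R : realType) (d : nat) (H : R) (m : 'I_d -> nat).

Definition coarse_pos (i : coarse_node m) : 'rV[R]_d :=
  \row_k ((i k)%:R * H).

Definition is_vertex (i : coarse_node m) (K : cell m) : bool :=
  [forall k, (i k == K k :> nat) || (i k == (K k).+1 :> nat)].

Definition in_cell (K : cell m) (x : 'rV[R]_d) : bool :=
  [forall k, (K k)%:R * H <= x 0 k <= (K k).+1%:R * H].

Definition in_patch (i : coarse_node m) (x : 'rV[R]_d) : bool :=
  [exists K : cell m, is_vertex i K && in_cell K x].

Definition hat (i : coarse_node m) (x : 'rV[R]_d) : R :=
  \prod_k Num.max 0 (1 - `|x 0 k - coarse_pos i 0 k| / H).

End CoarseMesh.

Section Multiscale.
Variables (R : realType) (d : nat) (ell : 'I_d -> R) (G : network ell).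

Definition subnet_edge (A : {set 'I_(nv G)}) : rel 'I_(nv G) :=
  [rel v v' | [&& v \in A, v' \in A & edge v v']].

Definition clusters (A : {set 'I_(nv G)}) : {set {set 'I_(nv G)}} :=
  [set [set v' in A | connect (subnet_edge A) v v'] | v in A].

(* When several clusters have maximal size, each of them qualifies. *)
Definition main_cluster (A S : {set 'I_(nv G)}) : Prop :=
  S \in clusters A /\ forall S', S' \in clusters A -> (#|S'| <= #|S|)%N.

Definition local_weight (S : {set 'I_(nv G)}) : 'M[R]_#|S| :=
  mxsub enum_val enum_val (weight G).

Definition local_degree (S : {set 'I_(nv G)}) : 'M[R]_#|S| :=
  degree_mx (local_weight S).

Definition local_laplacian (S : {set 'I_(nv G)}) : 'M[R]_#|S| :=
  graph_laplacian (local_weight S).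

(* A complete (linearly independent) family of eigenvectors of the pencil
   (L^omega, D^omega), ordered by increasing eigenvalue with multiplicity. *)
Definition local_eigensystem (S : {set 'I_(nv G)})
    (lam : (#|S|).-tuple R) (phi : (#|S|).-tuple 'cV[R]_#|S|) : Prop :=
  [/\ forall r : 'I_#|S|,
        local_laplacian S *m tnth phi r
        = tnth lam r *: (local_degree S *m tnth phi r),
      sorted <=%R lam
    & free phi].

Definition extend0 (S : {set 'I_(nv G)}) (phi : 'cV[R]_#|S|) : 'cV[R]_(nv G) :=
  \col_v \sum_(a | enum_val a == v) phi a 0.

Variables (H : R) (m : 'I_d -> nat).

Definition patch_nodes (i : coarse_node m) : {set 'I_(nv G)} :=
  [set v | in_patch H i (pos v)].

(* Already extended by zero outside the patch. *)
Definition eta (i : coarse_node m) (S : {set 'I_(nv G)}) : 'cV[R]_(nv G) :=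
  \col_v ((v \in patch_nodes i) && (v \notin S))%:R.

Definition hat_mul (i : coarse_node m) (g : 'cV[R]_(nv G)) : 'cV[R]_(nv G) :=
  \col_v (hat H i (pos v) * g v 0).

(* The sequence psi_1, psi_2, psi_3, ... = chi eta, chi phi_1, chi phi_2, ...
   of functions on all the network nodes. *)
Definition local_basis (i : coarse_node m) (S : {set 'I_(nv G)})
    (phi : seq 'cV[R]_#|S|) : seq 'cV[R]_(nv G) :=
  hat_mul i (eta i S) :: [seq hat_mul i (extend0 p) | p <- phi].

(* The first M i local functions of every coarse node i, restricted to the
   nodes that are not eliminated. *)
Definition Vms (Dir : {set 'I_(nv G)}) (S : coarse_node m -> {set 'I_(nv G)})
    (phi : forall i, (#|S i|).-tuple 'cV[R]_#|S i|) (M : coarse_node m -> nat) :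
    {vspace 'cV[R]_(ndof Dir)} :=
  <<[seq rowsub (@dof _ _ _ _ Dir) psi
      | i <- enum (coarse_node m), psi <- take (M i) (local_basis i (phi i))]>>%VS.

End Multiscale.

(* Backward Euler Galerkin scheme in the space X, at the times t_n = n tau. *)
Definition backward_euler (R : realType) (N : nat) (C L : 'M[R]_N)
    (X : {vspace 'cV[R]_N}) (tau : R) (f : R -> 'cV[R]_N)
    (u : nat -> 'cV[R]_N) : Prop :=
  (forall n, u n \in X) /\
  forall n v, (1 <= n)%N -> v \in X ->
    dotv (C *m (tau^-1 *: (u n - u n.-1))) v + dotv (L *m u n) v
    = dotv (f (n%:R * tau)) v.

(* Main.v *)
Require Import Defs.
From HB Require Import structures.
From mathcomp Require Import all_boot all_order all_algebra.
From mathcomp Require Import reals.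
From mathcomp Require Import ring lra.

Set Implicit Arguments.
Unset Strict Implicit.
Unset Printing Implicit Defensive.

Import Order.TTheory GRing.Theory Num.Theory.
Local Open Scope ring_scope.

(** The estimate is the discrete energy identity obtained by testing the scheme
    with the increment [w = u n - u n.-1], which lies in the trial space because
    both iterates do.  Polarization of the symmetric form [L] gives
      [(L u_n, w) = (|u_n|_L^2 - |u_(n-1)|_L^2 + |w|_L^2) / 2],
    so that, with [A = C + (tau / 2) L],
      [|w|_A^2 / tau + (|u_n|_L^2 - |u_(n-1)|_L^2) / 2 = (f_n, w)].
    The numerical dissipation of backward Euler, [|w|_L^2 / 2], is what turns
    the [C]-norm of the increment into its [A]-norm; this is why the data enter
    through the dual norm of [A] and why [tau] is unrestricted.
    Young's inequality in the dual pair of norms of [A] and [invmx A]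
    ([dotv_le_young]),
      [(f_n, w) <= |w|_A^2 / tau + (tau / 4) |f_n|_(A^-1)^2],
    absorbs the increment completely, leaving
      [|u_n|_L^2 <= |u_(n-1)|_L^2 + (tau / 2) |f_n|_(A^-1)^2]
    ([backward_euler_step]).  Summing over the steps gives the theorem with the
    constant 1, since the data terms are nonnegative.

    What remains is that [A] is positive definite.  The matrix [L] is a
    principal submatrix of a graph Laplacian with nonnegative weights, whose
    quadratic form is a sum of squares of edge differences
    ([normsq_graph_laplacian]), and [C] is diagonal with positive entries. *)

(** * Quadratic forms on column vectors *)

Section QuadraticForms.
Variables (R : realType) (n : nat).
Implicit Types (u v w f : 'cV[R]_n) (A B : 'M[R]_n).

Lemma dotvE u v : dotv u v = \sum_i u i 0 * v i 0.
Proof. by rewrite /dotv mxE; apply: eq_bigr => i _; rewrite mxE. Qed.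

Lemma dotvC u v : dotv u v = dotv v u.
Proof. by rewrite !dotvE; apply: eq_bigr => i _; rewrite mulrC. Qed.

Lemma dotvBr u v w : dotv u (v - w) = dotv u v - dotv u w.
Proof. by rewrite /dotv mulmxBr !mxE. Qed.

Lemma dotvZr a u v : dotv u (a *: v) = a * dotv u v.
Proof. by rewrite /dotv -scalemxAr mxE. Qed.

Lemma dotvBl u v w : dotv (u - v) w = dotv u w - dotv v w.
Proof. by rewrite dotvC dotvBr !(dotvC w). Qed.

Lemma dotvZl a u v : dotv (a *: u) v = a * dotv u v.
Proof. by rewrite dotvC dotvZr dotvC. Qed.

Lemma dotv_mulmxl A u v : dotv (A *m u) v = dotv u (A^T *m v).
Proof. by rewrite /dotv trmx_mul mulmxA. Qed.

Lemma normsqE A u : normsq A u = dotv u (A *m u).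
Proof. by rewrite /normsq /dotv mulmxA. Qed.

Lemma normsqDZ A B a u : normsq (A + a *: B) u = normsq A u + a * normsq B u.
Proof.
by rewrite !normsqE mulmxDl -scalemxAl /dotv mulmxDr -scalemxAr !mxE.
Qed.

Lemma polarization B u v : B^T = B ->
  dotv (B *m u) (u - v) = (normsq B u - normsq B v + normsq B (u - v)) / 2.
Proof.
move=> symB; rewrite !normsqE mulmxBr !dotvBl !dotvBr.
have -> : dotv v (B *m u) = dotv u (B *m v) by rewrite dotvC dotv_mulmxl symB.
by rewrite !dotv_mulmxl symB; field.
Qed.

(** A vector in the kernel of [A] has zero energy, so [A] has no kernel. *)
Lemma posdef_unitmx A :
  (forall u, u != 0 -> 0 < normsq A u) -> A \in unitmx.
Proof.
move=> posA; rewrite -unitmx_tr -row_free_unit; apply/row_freeP.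
suff kerA : kermx A^T = 0.
  by apply/row_freeP; rewrite -kermx_eq0 kerA.
apply/eqP/rowV0P => v /sub_kermxP vA.
apply/eqP; apply: contraT => v_neq0.
have : 0 < normsq A v^T by apply: posA; rewrite -(inj_eq trmx_inj) trmxK trmx0.
have -> : normsq A v^T = 0.
  by rewrite normsqE -[A in A *m _]trmxK -trmx_mul vA trmx0 /dotv mulmx0 mxE.
by rewrite ltxx.
Qed.

(** Completing the square: the gap between the two sides is
    [tau^-1 * normsq A (w - (tau / 2) *: (invmx A *m f))]. *)
Lemma dotv_le_young A (tau : R) f w : 0 < tau -> A^T = A -> A \in unitmx ->
    (forall u, 0 <= normsq A u) ->
  dotv f w <= tau^-1 * normsq A w + tau / 4 * normsq (invmx A) f.
Proof.
move=> tau_gt0 symA unitA psdA.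
pose g := invmx A *m f.
have Ag : A *m g = f by rewrite mulKVmx.
have := psdA (w - (tau / 2) *: g).
rewrite !normsqE mulmxBr -scalemxAr Ag dotvBl !dotvBr !dotvZl !dotvZr.
have -> : dotv g (A *m w) = dotv f w by rewrite -Ag dotv_mulmxl symA.
rewrite (dotvC w f) (dotvC g f) -/g => sq_ge0.
rewrite -subr_ge0.
set a := dotv w _ in sq_ge0 *; set b := dotv f w in sq_ge0 *.
set c := dotv f g in sq_ge0 *.
have -> : tau^-1 * a + tau / 4 * c - b =
    tau^-1 * (a - tau / 2 * b - (tau / 2 * b - tau / 2 * (tau / 2 * c))).
  by field; rewrite gt_eqF.
by rewrite mulr_ge0 // invr_ge0 ltW.
Qed.

End QuadraticForms.

(** * Stability of the backward Euler Galerkin scheme *)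

Section BackwardEuler.
Variables (R : realType) (N : nat) (C L : 'M[R]_N).
Hypotheses (symC : C^T = C) (posC : forall u, u != 0 -> 0 < normsq C u).
Hypotheses (symL : L^T = L) (psdL : forall u, 0 <= normsq L u).
Variables (X : {vspace 'cV[R]_N}) (tau : R) (f : R -> 'cV[R]_N).
Variable u : nat -> 'cV[R]_N.
Hypotheses (tau_gt0 : 0 < tau) (scheme_u : backward_euler C L X tau f u).

Let A := C + (tau / 2) *: L.

Let posA v : v != 0 -> 0 < normsq A v.
Proof.
move=> v_neq0; rewrite normsqDZ ltr_wpDr ?posC //.
by rewrite mulr_ge0 // ltW // divr_gt0.
Qed.

Let psdA v : 0 <= normsq A v.
Proof.
have [->|v_neq0] := eqVneq v 0; last exact/ltW/posA.
by rewrite normsqE mulmx0 /dotv mulmx0 mxE.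
Qed.

(** The case [v = u n.+1 - u n] of the scheme, where Young's inequality with
    parameter [tau] cancels the energy of the increment exactly. *)
Lemma backward_euler_step n :
  normsq L (u n.+1) <=
    normsq L (u n) + tau / 2 * normsq (invmx A) (f (n.+1%:R * tau)).
Proof.
have [uX scheme] := scheme_u.
set w := u n.+1 - u n.
have wX : w \in X by rewrite rpredB.
have := scheme n.+1 w isT wX.
rewrite /= -/w polarization // -/w -scalemxAr dotvZl => energy.
have CwE : dotv (C *m w) w = normsq C w by rewrite normsqE dotvC.
have symA : A^T = A by rewrite /A linearD linearZ /= symC symL.
have := dotv_le_young (f (n.+1%:R * tau)) w tau_gt0 symA (posdef_unitmx posA) psdA.
rewrite -energy CwE {1}/A normsqDZ.
have -> : tau^-1 * (normsq C w + tau / 2 * normsq L w)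
          = tau^-1 * normsq C w + normsq L w / 2 by field; rewrite gt_eqF.
lra.
Qed.

Lemma backward_euler_stability n :
  normsq L (u n) <= normsq L (u 0%N) + tau / 2 *
    \sum_(1 <= k < n.+1) normsq (invmx A) (f (k%:R * tau)).
Proof.
elim: n => [|n IHn]; first by rewrite big_geq // mulr0 addr0.
rewrite big_nat_recr //= mulrDr addrA.
by apply: le_trans (backward_euler_step n) _; rewrite lerD2r.
Qed.

(** The [invmx A]-norm of [v] is the [A]-norm of [invmx A *m v]. *)
Lemma normsq_invmx_ge0 v : 0 <= normsq (invmx A) v.
Proof.
have := psdA (invmx A *m v).
by rewrite !normsqE mulKVmx ?posdef_unitmx // dotvC.
Qed.

End BackwardEuler.

(** * The stiffness and mass matrices of a network *)

Lemma normsq_diag_mx (R : realType) n (d : 'rV[R]_n) (u : 'cV[R]_n) :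
  normsq (diag_mx d) u = \sum_i d 0 i * u i 0 ^+ 2.
Proof.
by rewrite normsqE mul_diag_mx dotvE; apply: eq_bigr => i _; rewrite mxE; ring.
Qed.

(** The half corrects for counting every undirected edge in both directions. *)
Lemma normsq_graph_laplacian (R : realType) n (W : 'M[R]_n) (u : 'cV[R]_n) :
  W^T = W ->
  normsq (graph_laplacian W) u =
    (\sum_i \sum_j W i j * (u i 0 - u j 0) ^+ 2) / 2.
Proof.
move=> symW.
have WC i j : W i j = W j i by rewrite -{1}symW mxE.
have diagE : normsq (degree_mx W) u = \sum_i \sum_j W i j * u i 0 ^+ 2.
  by rewrite normsq_diag_mx; apply: eq_bigr => i _; rewrite mxE mulr_suml.
have offE : normsq W u = \sum_i \sum_j W i j * (u i 0 * u j 0).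
  rewrite normsqE dotvE; apply: eq_bigr => i _.
  by rewrite mxE mulr_sumr; apply: eq_bigr => j _; ring.
have diagE' : normsq (degree_mx W) u = \sum_i \sum_j W i j * u j 0 ^+ 2.
  rewrite diagE exchange_big; apply: eq_bigr => i _.
  by apply: eq_bigr => j _; rewrite WC.
have -> : normsq (graph_laplacian W) u = normsq (degree_mx W) u - normsq W u.
  by rewrite !normsqE /graph_laplacian mulmxBl dotvBr.
have -> : \sum_i \sum_j W i j * (u i 0 - u j 0) ^+ 2 =
    normsq (degree_mx W) u + normsq (degree_mx W) u - normsq W u *+ 2.
  rewrite {1}diagE diagE' offE -sumrMnl -big_split -sumrB /=.
  apply: eq_bigr => i _; rewrite -sumrMnl -big_split -sumrB /=.
  by apply: eq_bigr => j _; ring.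
by field.
Qed.

(** For injective [g], the vector [(rowsub g 1%:M)^T *m u] is the extension of
    [u] by zero; positive semidefiniteness thus passes from a matrix to its
    principal submatrices. *)
Lemma normsq_mxsub (R : realType) n k (g : 'I_k -> 'I_n) (B : 'M[R]_n)
    (u : 'cV[R]_k) :
  normsq (mxsub g g B) u = normsq B ((rowsub g 1%:M)^T *m u).
Proof.
rewrite /normsq trmx_mul trmxK !mulmxA.
have -> : mxsub g g B = rowsub g 1%:M *m B *m (rowsub g 1%:M)^T.
  apply/matrixP => a b; rewrite -rowsubE trmx_mxsub trmx1 mulmx_colsub mulmx1.
  by rewrite !mxE.
by rewrite !mulmxA.
Qed.

Section NetworkMatrices.
Variables (R : realType) (d : nat) (ell : 'I_d -> R) (G : network ell).
Variable Dir : {set 'I_(nv G)}.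

Lemma weight_ge0 (v v' : 'I_(nv G)) : 0 <= weight G v v'.
Proof.
have [vv'|/weight_nonedge -> //] := boolP (edge v v').
have /andP[lo_le _] := weight_edge vv'.
exact: le_trans (ltW (weight_lo_gt0 G)) lo_le.
Qed.

Lemma L_mx_sym : (L_mx Dir)^T = L_mx Dir.
Proof.
rewrite /L_mx trmx_mxsub /graph_laplacian /degree_mx.
by rewrite linearB /= tr_diag_mx weight_sym.
Qed.

Lemma L_mx_psd u : 0 <= normsq (L_mx Dir) u.
Proof.
rewrite normsq_mxsub normsq_graph_laplacian ?weight_sym // divr_ge0 //.
apply: sumr_ge0 => i _; apply: sumr_ge0 => j _.
by rewrite mulr_ge0 ?weight_ge0 ?sqr_ge0.
Qed.

Lemma C_mxE : C_mx Dir = diag_mx (\row_a coef G 0 (dof a)).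
Proof.
by apply/matrixP => a b; rewrite !mxE (inj_eq enum_val_inj).
Qed.

Lemma C_mx_sym : (C_mx Dir)^T = C_mx Dir.
Proof. by rewrite C_mxE tr_diag_mx. Qed.

Lemma C_mx_posdef u : u != 0 -> 0 < normsq (C_mx Dir) u.
Proof.
move=> /cV0Pn[a ua_neq0]; rewrite C_mxE normsq_diag_mx.
have coef_gt0 v : 0 < coef G 0 v.
  by have /andP[lo_le _] := coef_bounds v; exact: lt_le_trans (coef_lo_gt0 G) lo_le.
rewrite (bigD1 a) //= ltr_pwDl //.
  by rewrite mxE mulr_gt0 // exprn_even_gt0.
by apply: sumr_ge0 => b _; rewrite mxE mulr_ge0 ?sqr_ge0 ?ltW.
Qed.

End NetworkMatrices.

(** * The multiscale scheme on a network *)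

Theorem lemma6 (R : realType) (d : nat) (hd : d = 2%N \/ d = 3%N)
    (ell : 'I_d -> R) (G : network ell) (Dir : {set 'I_(nv G)})
    (H : R) (m : 'I_d -> nat) (hH : 0 < H) (hm : forall k, (0 < m k)%N)
    (hmesh : forall k, ell k = (m k)%:R * H)
    (S : coarse_node m -> {set 'I_(nv G)})
    (hS : forall i, main_cluster (patch_nodes G H i) (S i))
    (hD : forall i, local_degree (S i) \in unitmx)
    (lam : forall i, (#|S i|).-tuple R)
    (phi : forall i, (#|S i|).-tuple 'cV[R]_#|S i|)
    (hphi : forall i, local_eigensystem (lam i) (phi i))
    (M : coarse_node m -> nat) (hM : forall i, (M i <= #|S i|.+1)%N) :
  exists c0 : R, 0 < c0 /\
    forall (tau : R) (f : R -> 'cV[R]_(ndof Dir)) (u : nat -> 'cV[R]_(ndof Dir)),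
      0 < tau ->
      backward_euler (C_mx Dir) (L_mx Dir) (Vms H Dir phi M) tau f u ->
      forall n : nat, (1 <= n)%N ->
        normsq (L_mx Dir) (u n)
        <= c0 * (normsq (L_mx Dir) (u 0%N)
                 + tau * \sum_(1 <= k < n.+1)
                     normsq (invmx (C_mx Dir + (tau / 2) *: L_mx Dir))
                            (f (k%:R * tau))).
Proof.
exists 1; split; first exact: ltr01.
move=> tau f u tau_gt0 scheme_u n _; rewrite mul1r.
have symC := C_mx_sym Dir; have posC := @C_mx_posdef _ _ _ _ Dir.
have symL := L_mx_sym Dir; have psdL := @L_mx_psd _ _ _ _ Dir.
apply: le_trans (backward_euler_stability symC posC symL psdL tau_gt0 scheme_u n) _.
rewrite lerD2l ler_wpM2r //; last by lra.
by apply: sumr_ge0 => k _; exact: normsq_invmx_ge0.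
Qed.
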